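(* There exists a finite simple planar graph that contains no cycle of length four and no cycle of length five, and that is not $3$-colorable (i.e., there is no map assigning to each vertex one of three colors such that adjacent vertices receive different colors).
   Context: A cycle of length $k$ in a graph is a subgraph consisting of $k$ distinct vertices $v_1,\ldots,v_k$ and the $k$ edges $v_1v_2, v_2v_3,\ldots,v_{k-1}v_k,v_kv_1$; the cycles need not be induced. *)

(* Defs.v *)
From HB Require Import structures.
From mathcomp Require Import all_boot all_order all_algebra.
From mathcomp Require Import all_classical all_reals all_analysis.
From mathcomp Require Import Rstruct Rstruct_topology.
Set Implicit Arguments. Unset Strict Implicit. Unset Printing Implicit Defensive.
Import Order.TTheory GRing.Theory Num.Theory.
Import numFieldNormedType.Exports.
Local Open Scope classical_set_scope.
Local Open Scope ring_scope.

Definition simple_graph (T : finType) (e : rel T) : Prop :=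
  symmetric e /\ irreflexive e.

Definition has_cycle_of_length (T : finType) (e : rel T) (k : nat) : Prop :=
  (3 <= k)%N /\
  exists v : 'I_k -> T, injective v /\
    forall i : 'I_k, e (v i) (v (ordS i)).

Definition three_colorable (T : finType) (e : rel T) : Prop :=
  exists c : T -> 'I_3, forall x y, e x y -> c x != c y.

Definition planar_in (R : realType) (T : finType) (e : rel T) : Prop :=
  exists (p : T -> R * R) (g : T -> T -> R -> R * R),
    injective p /\
    (forall x y, e x y ->
       [/\ {within `[0%R, 1%R], continuous (g x y)},
           g x y 0 = p x, g x y 1 = p y,
           (forall s t, 0 <= s <= 1 -> 0 <= t <= 1 -> g x y s = g x y t -> s = t)
         & (forall t z, 0 < t < 1 -> g x y t <> p z)]) /\
    (forall x y u v, e x y -> e u v -> ~ ((x = u /\ y = v) \/ (x = v /\ y = u)) ->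
       forall s t, 0 <= s <= 1 -> 0 <= t <= 1 -> g x y s = g u v t ->
         (g x y s = p x \/ g x y s = p y) /\ (g u v t = p u \/ g u v t = p v)).

Definition planar (T : finType) (e : rel T) : Prop :=
  planar_in Rdefinitions.R e.

(* Main.v *)
(** A net is a triangle with a pendant edge at each corner; its three pendant
    vertices cannot all have the same color.  In the 17-vertex graph [transfer],
    every 3-coloring that agrees on the vertices 0 and 1 gives that color to the
    vertex 2 as well.  Glue two copies of [transfer] along 0 and 1 and attach a
    net to 1 and to the two copies of 2: a 3-coloring of this [quasi_edge] must
    separate 0 from 1, for otherwise all pendant vertices of the net would have
    the same color.  The ends of a quasi-edge are at distance three, so joining a
    new vertex by quasi-edges to the three corners of a triangle creates no short
    cycle, and the result behaves like the complete graph on four vertices.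
    Planarity is witnessed by a straight-line drawing with integer coordinates, in
    which any two segments without a common endpoint are separated by a linear
    functional. *)

Require Import Defs.
From HB Require Import structures.
From mathcomp Require Import all_boot all_order all_algebra.
From mathcomp Require Import all_classical all_reals all_analysis.
From mathcomp Require Import ssrZ.
From Stdlib Require Import ZArith Lia.
From mathcomp Require Import lra ring.

Set Implicit Arguments. Unset Strict Implicit. Unset Printing Implicit Defensive.
Import Order.TTheory GRing.Theory Num.Theory.
Import numFieldNormedType.Exports.

Local Open Scope nat_scope.

(** * Graphs as edge lists and the enumeration of their colorings *)

Definition edge_rel (n : nat) (S : seq (nat * nat)) : rel 'I_n :=
  fun x y => ((val x, val y) \in S) || ((val y, val x) \in S).

Definition proper (S : seq (nat * nat)) (c : nat -> nat) : bool :=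
  all (fun e => c e.1 != c e.2) S.

Definition relabel (f : nat -> nat) (S : seq (nat * nat)) : seq (nat * nat) :=
  [seq (f e.1, f e.2) | e <- S].

Lemma proper_relabel f S c : proper (relabel f S) c = proper S (c \o f).
Proof. by rewrite /proper all_map. Qed.

Lemma proper_cat S1 S2 c : proper (S1 ++ S2) c = proper S1 c && proper S2 c.
Proof. exact: all_cat. Qed.

(** Backtracking: a partial coloring is dropped as soon as an edge between colored vertices is
    violated, which keeps the enumeration small enough to evaluate. *)
Fixpoint colorings (q : nat) (S : seq (nat * nat)) (n : nat) : seq (seq nat) :=
  if n is k.+1 then
    [seq t <- [seq rcons s x | s <- colorings q S k, x <- iota 0 q]
       | proper [seq e <- S | (e.1 <= k) && (e.2 <= k)] (nth 0 t)]
  else [:: [::]].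

Lemma mem_colorings q S c n :
  proper S c -> (forall i, c i < q) -> mkseq c n \in colorings q S n.
Proof.
move=> Sc cq; elim: n => [|k IHk] //=.
rewrite mem_filter; apply/andP; split.
  apply/allP => e; rewrite mem_filter => /andP[/andP[e1 e2] eS].
  by rewrite !nth_mkseq ?ltnS //; exact: (allP Sc).
rewrite /mkseq -addn1 iotaD map_cat cats1.
by apply/allpairsP; exists (mkseq c k, c k); rewrite mem_iota cq IHk.
Qed.

(** * The gadgets and the failure of 3-colorability *)

(** Found by a computer search over plane graphs. *)
Definition transfer : seq (nat * nat) :=
  [::
   (0, 3); (0, 5); (0, 7); (1, 6); (1, 8); (2, 3); (2, 4); (3, 4); (4, 9);
   (4, 10); (5, 6); (5, 7); (5, 12); (6, 8); (6, 12); (7, 11); (8, 9);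
   (8, 13); (9, 10); (9, 13); (10, 11); (11, 16); (12, 14); (13, 15);
   (14, 15); (14, 16); (15, 16)].

Lemma transfer_colorings :
  all (fun s => (nth 0 s 0 == nth 0 s 1) ==> (nth 0 s 2 == nth 0 s 0))
    (colorings 3 transfer 17).
Proof. by vm_compute. Qed.

Lemma transferP c :
  proper transfer c -> (forall i, c i < 3) -> c 0 = c 1 -> c 2 = c 0.
Proof.
move=> tc c3 c01; have := allP transfer_colorings _ (mem_colorings 17 tc c3).
by rewrite !nth_mkseq // c01 eqxx => /eqP.
Qed.

(** [s] lists the images of the first vertices of a gadget; the remaining
    vertices become [m], [m + 1], and so on. *)
Definition attach (s : seq nat) (m i : nat) : nat :=
  if i < size s then nth 0 s i else m + (i - size s).

(** The net has corners 4, 5, 6 and pendant vertices 2, 3, 1, where 2 and 3 are the two copies of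
    vertex 2 of [transfer]. Each copy brings 17 - 3 = 14 new vertices, hence the offsets 7 and 21
    and a total of 35. *)
Definition quasi_edge : seq (nat * nat) :=
  [:: (2, 4); (3, 5); (1, 6); (4, 5); (4, 6); (5, 6)]
  ++ relabel (attach [:: 0; 1; 2] 7) transfer
  ++ relabel (attach [:: 0; 1; 3] 21) transfer.

Lemma quasi_edgeP c : proper quasi_edge c -> (forall i, c i < 3) -> c 0 != c 1.
Proof.
rewrite !proper_cat !proper_relabel => /and3P[net t1 t2] c3.
apply/eqP => c01.
have c20 : c 2 = c 0 := transferP t1 (fun i => c3 _) c01.
have c30 : c 3 = c 0 := transferP t2 (fun i => c3 _) c01.
(* All three pendant vertices now have the color of 0, so only two colors are left for the triangle
   4, 5, 6. *)
move: net (c3 0) (c3 4) (c3 5) (c3 6); rewrite /= c20 c30 -c01.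
by case: (c 0) (c 4) (c 5) (c 6) => [|[|[|?]]] [|[|[|?]]] [|[|[|?]]] [|[|[|?]]].
Qed.

(** Vertex 0 is the apex over the triangle 1, 2, 3. Each quasi-edge brings 35 - 2 = 33 new vertices,
    so there are 4 + 3 * 33 = 103. *)
Definition steinberg : seq (nat * nat) :=
  [:: (1, 2); (1, 3); (2, 3)]
  ++ relabel (attach [:: 0; 1] 4) quasi_edge
  ++ relabel (attach [:: 0; 2] 37) quasi_edge
  ++ relabel (attach [:: 0; 3] 70) quasi_edge.

Lemma steinberg_not_proper c : (forall i, c i < 3) -> ~~ proper steinberg c.
Proof.
move=> c3; apply/negP; rewrite !proper_cat !proper_relabel.
case/and4P=> tri /quasi_edgeP h1 /quasi_edgeP h2 /quasi_edgeP h3.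
have c01 : c 0 != c 1 := h1 (fun i => c3 _).
have c02 : c 0 != c 2 := h2 (fun i => c3 _).
have c03 : c 0 != c 3 := h3 (fun i => c3 _).
move: tri c01 c02 c03 (c3 0) (c3 1) (c3 2) (c3 3) => /= {h1 h2 h3}.
by case: (c 0) (c 1) (c 2) (c 3) => [|[|[|?]]] [|[|[|?]]] [|[|[|?]]] [|[|[|?]]].
Qed.

Definition in_range (n : nat) (S : seq (nat * nat)) : bool :=
  all (fun e => (e.1 < n) && (e.2 < n)) S.

Lemma not_three_colorable n S :
  in_range n S ->
  (forall c, (forall i, c i < 3) -> ~~ proper S c) ->
  ~ three_colorable (@edge_rel n S).
Proof.
move=> Sn Sc [c cP].
(* The default color 0 outside the range is harmless, since every edge has its ends below [n]. *)
pose c' i := if insub i is Some x then val (c x) else 0.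
have c'3 i : c' i < 3 by rewrite /c'; case: insub => // x; exact: ltn_ord.
move/negP: (Sc _ c'3); apply; apply/allP => -[x y] xyS /=.
have /andP[/= xn yn] := allP Sn _ xyS.
rewrite /c' !insubT /=; apply: (cP (Sub x xn) (Sub y yn)).
by rewrite /edge_rel /= xyS.
Qed.

(** * Exclusion of short cycles *)

Definition adjacent (S : seq (nat * nat)) (x : nat) : seq nat :=
  [seq e.2 | e <- S & e.1 == x] ++ [seq e.1 | e <- S & e.2 == x].

Lemma edge_adjacent n S (x y : 'I_n) : edge_rel S x y -> val y \in adjacent S (val x).
Proof.
rewrite mem_cat => /orP[] xyS; apply/orP; [left|right].
  by apply/mapP; exists (val x, val y) => //; rewrite mem_filter eqxx.
by apply/mapP; exists (val y, val x) => //; rewrite mem_filter eqxx.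
Qed.

(** Depth-first search for a cycle through [x0], along self-avoiding walks; [N] is a table of
    neighbor lists, so that these are computed only once. *)
Fixpoint no_return (N : seq (seq nat)) (x0 k : nat) (visited : seq nat) (x : nat) :=
  if k is j.+1 then
    all (fun y => (y \in visited) || no_return N x0 j (y :: visited) y) (nth [::] N x)
  else x0 \notin nth [::] N x.

Lemma no_returnP (T : eqType) (e : rel T) (f : T -> nat) N x0 visited x p :
  injective f -> (forall x y, e x y -> f y \in nth [::] N (f x)) ->
  no_return N (f x0) (size p) (map f visited) (f x) ->
  path e x p -> uniq (p ++ visited) -> ~~ e (last x p) x0.
Proof.
move=> f_inj eN; elim: p visited x => [|y p IHp] visited x /=.
  by move=> xN _ _; apply: contra xN; exact: eN.
move=> /allP xN /andP[exy yp] /andP[yp' up].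
have := xN _ (eN _ _ exy); rewrite mem_map // => /orP[yv|].
  by rewrite mem_cat yv orbT in yp'.
move=> /(IHp (y :: visited)); apply => //.
by rewrite uniq_catC /= mem_cat orbC -mem_cat yp' uniq_catC.
Qed.

(** The starting vertex counts towards the length, hence [k.-1] further steps. *)
Definition cycle_free (n : nat) (S : seq (nat * nat)) (k : nat) : bool :=
  let N := mkseq (adjacent S) n in
  all (fun x => no_return N x k.-1 [:: x] x) (iota 0 n).

Lemma cycle_freeP n S k : cycle_free n S k -> ~ has_cycle_of_length (@edge_rel n S) k.
Proof.
move=> Sk [k3 [v [v_inj ve]]]; case: k => [|k] // in k3 v v_inj ve Sk *.
(* The cycle now has [k.+1] vertices. Indexed by naturals, [ordS] is the successor below [k]; its
   wrap-around at [k] is the closing edge that the search excludes. *)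
pose w i := v (inord i).
pose p := map w (iota 1 k).
have wS i : i < k -> edge_rel S (w i) (w i.+1).
  move=> ik; have := ve (inord i); congr edge_rel.
  by apply: congr1; apply/val_inj; rewrite /= !inordK ?modn_small // ltnS // ltnW.
have pw : path (@edge_rel n S) (w 0) p.
  rewrite /p; apply/(pathP (w 0)) => i; rewrite size_map size_iota => ik.
  rewrite (nth_map 0) ?size_iota // nth_iota // add1n.
  case: i ik => [|i] ik /=; first exact: wS.
  by rewrite (nth_map 0) ?size_iota ?nth_iota ?(ltnW ik) // add1n; exact: wS.
have up : uniq (p ++ [:: w 0]).
  rewrite uniq_catC -[_ ++ _]/(map w (iota 0 k.+1)) map_inj_in_uniq ?iota_uniq //.
  move=> i j; rewrite !mem_iota !add0n => /andP[_ ik] /andP[_ jk] /v_inj /(congr1 val).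
  by rewrite /= !inordK.
have eN (x y : 'I_n) : edge_rel S x y -> val y \in nth [::] (mkseq (adjacent S) n) (val x).
  by rewrite nth_mkseq ?ltn_ord //; exact: edge_adjacent.
have sp : size p = k by rewrite size_map size_iota.
have := allP Sk (val (w 0)); rewrite mem_iota add0n ltn_ord /= -{1}sp => /(_ isT) h.
have /negP := no_returnP val_inj eN (visited := [:: w 0]) h pw up; apply.
have -> : last (w 0) p = w k.
  by rewrite /p last_map; congr w; rewrite -nth_last size_iota nth_iota ?add1n prednK // -ltnS ltnW.
have := ve (inord k); congr edge_rel.
by apply: congr1; apply/val_inj; rewrite /= !inordK ?modnn.
Qed.

Local Open Scope ring_scope.

(** * Intersections of segments, decided by integer arithmetic *)

Definition dot (k q : Z * Z) : Z := (k.1 * q.1 + k.2 * q.2)%Z.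

Definition normal (a b : Z * Z) : Z * Z := ((a.2 - b.2)%Z, (b.1 - a.1)%Z).

Definition separates (a b u v k : Z * Z) : bool :=
  (Z.max (dot k a) (dot k b) <? Z.min (dot k u) (dot k v))%Z
  || (Z.max (dot k u) (dot k v) <? Z.min (dot k a) (dot k b))%Z.

(** Two disjoint segments that are not collinear are separated by the normal of one
    of them; the coordinate projections are a shortcut that settles most pairs and
    cover the collinear ones. *)
Definition separated (a b u v : Z * Z) : bool :=
  has (separates a b u v) [:: (1%Z, 0%Z); (0%Z, 1%Z); normal a b; normal u v].

(** The two values differ by the determinant of [v - a] and [b - a]. *)
Definition noncollinear (a b v : Z * Z) : bool :=
  ~~ (dot (normal a v) b =? dot (normal a v) a)%Z.

(** Coordinates stay in [Z] for fast evaluation; passing through [int] makes the ring morphism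
    lemmas available. *)
Definition zr (R : realType) (z : Z) : R := (int_of_Z z)%:~R.

Definition realpt (R : realType) (q : Z * Z) : R * R := (zr R q.1, zr R q.2).

Definition segment (R : realType) (a b : R * R) (t : R) : R * R :=
  ((1 - t) * a.1 + t * b.1, (1 - t) * a.2 + t * b.2).

Definition on_segment (R : realType) (a b q : R * R) : Prop :=
  exists t : R, 0 <= t <= 1 /\ q = segment a b t.

Definition rdot (R : realType) (k q : R * R) : R := k.1 * q.1 + k.2 * q.2.

Lemma zr_lt (R : realType) (x y : Z) : (x < y)%Z -> zr R x < zr R y.
Proof. by move=> xy; rewrite /zr ltr_int; lia. Qed.

Lemma zr_inj (R : realType) : injective (zr R).
Proof. by move=> x y /intr_inj /(can_inj int_of_ZK). Qed.

Section Segments.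
Variable R : realType.
Implicit Types (q : R * R) (a b u v k : Z * Z).

Lemma rdot_realpt k a : rdot (realpt R k) (realpt R a) = zr R (dot k a).
Proof. by rewrite /dot /zr [int_of_Z _]rmorphD !rmorphM rmorphD !rmorphM. Qed.

Lemma rdot_segment (k a b : R * R) t :
  rdot k (segment a b t) = (1 - t) * rdot k a + t * rdot k b.
Proof. by rewrite /rdot /segment /=; ring. Qed.

Lemma on_segmentC (a b : R * R) q : on_segment a b q -> on_segment b a q.
Proof.
case=> t [/andP[t0 t1] ->]; exists (1 - t); split; first lra.
by rewrite /segment subKr; congr pair; rewrite addrC.
Qed.

Lemma convex_combination_lt (x y z t : R) :
  0 <= t <= 1 -> x < z -> y < z -> (1 - t) * x + t * y < z.
Proof.
move=> /andP[t0 t1] xz yz; have [xy|/ltW yx] := leP x y.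
  by apply: le_lt_trans yz; nra.
by apply: le_lt_trans xz; nra.
Qed.

Lemma separates_disjoint a b u v k q : separates a b u v k ->
  on_segment (realpt R a) (realpt R b) q -> ~ on_segment (realpt R u) (realpt R v) q.
Proof.
wlog sep : a b u v / (Z.max (dot k a) (dot k b) < Z.min (dot k u) (dot k v))%Z.
  move=> IH /orP[] /Z.ltb_lt h qab quv.
    by apply: (IH a b u v) qab quv => //; rewrite /separates; move/Z.ltb_lt: h => ->.
  by apply: (IH u v a b) quv qab => //; rewrite /separates; move/Z.ltb_lt: h => ->.
move=> _ [s [s01 ->]] [t [t01 /(congr1 (rdot (realpt R k)))]].
rewrite !rdot_segment !rdot_realpt.
have au : zr R (dot k a) < zr R (dot k u) by apply: zr_lt; lia.
have av : zr R (dot k a) < zr R (dot k v) by apply: zr_lt; lia.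
have bu : zr R (dot k b) < zr R (dot k u) by apply: zr_lt; lia.
have bv : zr R (dot k b) < zr R (dot k v) by apply: zr_lt; lia.
(* The value at the point of the first segment lies below those at [u] and [v]. Negating turns the
   same convexity lemma into the bound for the second segment. *)
have := convex_combination_lt s01 au bu; have := convex_combination_lt s01 av bv.
rewrite -ltrN2 => hv; rewrite -ltrN2 => hu e.
by have := convex_combination_lt t01 hu hv; rewrite e !mulrN -opprD ltxx.
Qed.

Lemma separated_disjoint a b u v q : separated a b u v ->
  on_segment (realpt R a) (realpt R b) q -> ~ on_segment (realpt R u) (realpt R v) q.
Proof. by case/hasP => k _; exact: separates_disjoint. Qed.

(** The functional [normal a v] is constant on the line through [a] and [v], but not along the
    segment from [a] to [b], where it takes that constant only at [a]. *)
Lemma noncollinear_meet a b v q : noncollinear a b v ->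
  on_segment (realpt R a) (realpt R b) q -> on_segment (realpt R a) (realpt R v) q ->
  q = realpt R a.
Proof.
move=> /negP nab [s [_ ->]] [t [_ /(congr1 (rdot (realpt R (normal a v))))]].
rewrite !rdot_segment !rdot_realpt.
have -> : dot (normal a v) v = dot (normal a v) a by rewrite /dot /normal /=; lia.
set x := zr R _; set y := zr R _ => e.
have xy : y - x != 0.
  by rewrite subr_eq0; apply/eqP => /zr_inj yx; apply: nab; apply/Z.eqb_eq.
have /eqP : s * (y - x) = 0 by move: e; lra.
rewrite mulf_eq0 (negbTE xy) orbF => /eqP ->.
by rewrite /segment subr0 !mul1r !mul0r !addr0.
Qed.

End Segments.

(** * Verified straight-line drawings are plane embeddings *)

Definition compatible (P : nat -> Z * Z) (e f : nat * nat) : bool :=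
  let: (x, y) := e in let: (u, v) := f in
  if x == u then noncollinear (P x) (P y) (P v)
  else if x == v then noncollinear (P x) (P y) (P u)
  else if y == u then noncollinear (P y) (P x) (P v)
  else if y == v then noncollinear (P y) (P x) (P u)
  else separated (P x) (P y) (P u) (P v).

(** As every vertex is the end of some edge, the conditions on pairs of edges also
    keep the vertices away from the interiors of the edges. *)
Definition plane_drawing (n : nat) (S : seq (nat * nat)) (D : seq (Z * Z)) : bool :=
  let P := nth (0%Z, 0%Z) D in
  [&& in_range n S, size D == n, uniq D,
      all (fun e => e.1 != e.2) S,
      all (fun x => has (fun e => (e.1 == x) || (e.2 == x)) S)
        (iota 0 n)
    & all (fun e => all (fun f => (e == f) || compatible P e f) S) S].

Lemma compatible_meet (R : realType) (P : nat -> Z * Z) x y u v q :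
  compatible P (x, y) (u, v) ->
  on_segment (realpt R (P x)) (realpt R (P y)) q ->
  on_segment (realpt R (P u)) (realpt R (P v)) q ->
  (q = realpt R (P x) \/ q = realpt R (P y)) /\ (q = realpt R (P u) \/ q = realpt R (P v)).
Proof.
rewrite /compatible => /[swap] qxy /[swap] quv.
have [e|_] := eqVneq x u.
  by move=> /noncollinear_meet h; rewrite -e in quv *; rewrite (h _ _ qxy quv); tauto.
have [e|_] := eqVneq x v.
  move=> /noncollinear_meet h; rewrite -e in quv *.
  by rewrite (h _ _ qxy (on_segmentC quv)); tauto.
have [e|_] := eqVneq y u.
  move=> /noncollinear_meet h; rewrite -e in quv *.
  by rewrite (h _ _ (on_segmentC qxy) quv); tauto.
have [e|_] := eqVneq y v.
  move=> /noncollinear_meet h; rewrite -e in quv *.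
  by rewrite (h _ _ (on_segmentC qxy) (on_segmentC quv)); tauto.
by move=> /separated_disjoint /(_ qxy quv).
Qed.

Lemma continuous_affine (R : realType) (a b : R) :
  continuous (fun t : R => (1 - t) * a + t * b).
Proof.
move=> t; apply: cvgD; apply: cvgM; try exact: cvg_cst; try exact: cvg_id.
by apply: cvgB; [exact: cvg_cst|exact: cvg_id].
Qed.

Lemma continuous_segment (R : realType) (a b : R * R) : continuous (segment a b).
Proof.
move=> t.
have h := cvg_pair (@continuous_affine R a.1 b.1 t) (@continuous_affine R a.2 b.2 t).
exact: h.
Qed.

Lemma segment_inj (R : realType) (a b : R * R) : a != b -> injective (segment a b).
Proof.
case: a b => [a1 a2] [b1 b2] /negP ab s t; rewrite /segment /= => -[e1 e2].
apply/eqP; rewrite -subr_eq0; apply/negPn/negP => st; apply: ab.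
have /eqP : (s - t) * (a1 - b1) = 0 by move: e1; lra.
have /eqP : (s - t) * (a2 - b2) = 0 by move: e2; lra.
by rewrite !mulf_eq0 (negbTE st) /= !subr_eq0 => /eqP -> /eqP ->.
Qed.

Lemma plane_drawing_planar (R : realType) n S D :
  plane_drawing n S D -> planar_in R (@edge_rel n S).
Proof.
case/and5P=> Sn /eqP sD uD loopless /andP[cover compat].
pose P := nth (0%Z, 0%Z) D.
pose p (x : 'I_n) : R * R := realpt R (P x).
have p_inj : injective p.
  move=> x y [/zr_inj h1 /zr_inj h2]; apply/val_inj/eqP.
  rewrite -(nth_uniq (0%Z, 0%Z) _ _ uD) ?sD ?ltn_ord //.
  by rewrite -!/(P _) (surjective_pairing (P x)) (surjective_pairing (P y)) h1 h2.
have neq (x y : 'I_n) : edge_rel S x y -> x != y.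
  by case/orP=> /(allP loopless); rewrite //= eq_sym.
have meet x y u v q : edge_rel S x y -> edge_rel S u v ->
    ~ (x = u /\ y = v \/ x = v /\ y = u) ->
    on_segment (p x) (p y) q -> on_segment (p u) (p v) q ->
    (q = p x \/ q = p y) /\ (q = p u \/ q = p v).
  (* [key] handles edges in their listed orientation; reversing segments yields the other cases. *)
  have key (x' y' u' v' : 'I_n) : (val x', val y') \in S -> (val u', val v') \in S ->
      ~ (x' = u' /\ y' = v') -> on_segment (p x') (p y') q -> on_segment (p u') (p v') q ->
      (q = p x' \/ q = p y') /\ (q = p u' \/ q = p v').
    move=> eS fS ne; apply: compatible_meet.
    have /orP[/eqP[e1 e2]|//] := allP (allP compat _ eS) _ fS.
    by case: ne; split; exact: val_inj.
  move=> /orP[xy|yx] /orP[uv|vu] ne hq hq'.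
  - by apply: key => // -[? ?]; apply: ne; left.
  - have [|? ?] := key _ _ _ _ xy vu _ hq (on_segmentC hq'); last by tauto.
    by move=> -[? ?]; apply: ne; right.
  - have [|? ?] := key _ _ _ _ yx uv _ (on_segmentC hq) hq'; last by tauto.
    by move=> -[? ?]; apply: ne; right.
  - have [|? ?] := key _ _ _ _ yx vu _ (on_segmentC hq) (on_segmentC hq'); last by tauto.
    by move=> -[? ?]; apply: ne; left.
exists p, (fun x y => segment (p x) (p y)); split=> //; split; last first.
  move=> x y u v xy uv ne s t s01 t01 e.
  have qxy : on_segment (p x) (p y) (segment (p x) (p y) s) by exists s.
  have quv : on_segment (p u) (p v) (segment (p x) (p y) s) by exists t.
  by have [? ?] := meet _ _ _ _ _ xy uv ne qxy quv; split=> //; rewrite -e.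
move=> x y xy; have pxy : p x != p y by apply: contraNneq (neq _ _ xy) => /p_inj ->.
have seg0 (a b : R * R) : segment a b 0 = a.
  by case: a => ? ?; rewrite /segment subr0 !mul1r !mul0r !addr0.
have seg1 (a b : R * R) : segment a b 1 = b.
  by case: b => ? ?; rewrite /segment subrr !mul1r !mul0r !add0r.
split=> //.
- exact/continuous_subspaceT/continuous_segment.
- by move=> s t _ _ /(segment_inj pxy).
move=> t z t01 tz.
(* Some edge [zw] starts at [z]. Either it is the edge [xy], or it meets [xy] at [p z], which [meet]
   allows only at an end of [xy]. *)
have zend : z = x \/ z = y.
  have [//|ne] := pselect (z = x \/ z = y); exfalso; apply: ne.
  have : val z \in iota 0 n by rewrite mem_iota add0n ltn_ord.
  case/(allP cover)/hasP => -[a b] abS /= /orP ab.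
  have /andP[/= an bn] := allP Sn _ abS.
  have [w zw] : exists w, edge_rel S z w.
    case: ab => /eqP e; [exists (Ordinal bn)|exists (Ordinal an)];
      by rewrite /edge_rel /= -e abS ?orbT.
  have [[[-> _]|[_ ->]]|ne'] := pselect (x = z /\ y = w \/ x = w /\ y = z).
  - by left.
  - by right.
  - have h0 : on_segment (p x) (p y) (p z).
      by exists t; rewrite tz; case/andP: t01 => /ltW -> /ltW ->.
    have h1 : on_segment (p z) (p w) (p z) by exists 0; rewrite lexx ler01 seg0.
    by have [[/p_inj ->|/p_inj ->] _] := meet _ _ _ _ _ xy zw ne' h0 h1; [left|right].
case/andP: t01 => t0 t1; case: zend tz => -> tz.
  by move: t0; rewrite (segment_inj pxy (etrans tz (esym (seg0 (p x) (p y))))) ltxx.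
by move: t1; rewrite (segment_inj pxy (etrans tz (esym (seg1 (p x) (p y))))) ltxx.
Qed.

(** * The explicit drawing and the conclusion *)

Definition drawing : seq (Z * Z) :=
  ([::
   (137, 136); (56, 36); (101, 82); (43, 35); (185, 51); (179, 47);
   (185, 49); (182, 49); (174, 60); (220, 52); (187, 53); (213, 59);
   (191, 80); (215, 57); (191, 79); (202, 67); (191, 55); (192, 55);
   (210, 60); (205, 64); (199, 61); (202, 63); (201, 64); (226, 46);
   (177, 45); (234, 38); (154, 37); (231, 41); (168, 53); (176, 46);
   (165, 44); (162, 42); (157, 39); (174, 47); (169, 51); (171, 49);
   (169, 50); (139, 97); (133, 93); (137, 96); (136, 95); (128, 106);
   (174, 98); (140, 100); (167, 105); (145, 126); (169, 103); (145, 125);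
   (156, 113); (145, 101); (147, 102); (164, 106); (159, 110); (153, 107);
   (156, 109); (155, 110); (180, 92); (131, 91); (188, 84); (108, 83);
   (185, 87); (124, 99); (130, 92); (119, 90); (116, 88); (111, 85);
   (127, 94); (123, 97); (125, 96); (123, 96); (25, 13); (19, 8); (22, 12);
   (21, 11); (42, 33); (258, 14); (27, 16); (251, 21); (52, 23); (253, 19);
   (50, 25); (43, 31); (30, 17); (32, 18); (38, 22); (47, 26); (43, 28);
   (46, 27); (43, 29); (265, 9); (267, 6); (137, 135); (143, 128); (0, 0);
   (136, 129); (12, 5); (269, 4); (274, 0); (138, 133); (136, 130);
   (137, 133); (137, 132); (7, 2)])%Z.

Theorem theorem5 :
  exists (T : finType) (e : rel T),
    [/\ simple_graph e, planar e,
        ~ has_cycle_of_length e 4, ~ has_cycle_of_length e 5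
      & ~ three_colorable e].
Proof.
exists 'I_103, (@edge_rel 103 steinberg); split.
- split; first by move=> x y; rewrite /edge_rel orbC.
  have loopless : all (fun e => e.1 != e.2) steinberg by vm_compute.
  by move=> x; apply/negP => /orP[] /(allP loopless); rewrite eqxx.
- by apply: (@plane_drawing_planar _ _ _ drawing); vm_compute.
- by apply: cycle_freeP; vm_compute.
- by apply: cycle_freeP; vm_compute.
- by apply: not_three_colorable steinberg_not_proper; vm_compute.
Qed.
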